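(* Consider the extended infinite horizon MPC closed loop (described in the context) with a general gain matrix $D_0$ (not necessarily regular) and any input horizon $m$. Assume that the spectral radius of $F$ is strictly smaller than $1$, and that the output reference $r$ is such that $r=D_0u_r$ for some $u_r\in\mathbb{U}$. Then the positive definite weighting matrix $S$ in the cost can be chosen such that $$\lim_{k\to\infty}V_k^*=0 .$$
   Context: Model. Let $F\in\mathbb{C}^{n_d\times n_d}$, $D_0\in\mathbb{R}^{n_y\times n_u}$, $D_d\in\mathbb{C}^{n_d\times n_u}$, $\Psi\in\mathbb{R}^{n_y\times n_d}$. For discrete times $k\ge 0$ the system has static state $x_s\in\mathbb{R}^{n_y}$, dynamic state $x_d\in\mathbb{C}^{n_d}$, input $u\in\mathbb{R}^{n_u}$ and (real) output $y\in\mathbb{R}^{n_y}$, with $$x_s(k+1)=x_s(k)+D_0(u(k+1)-u(k)),\quad x_d(k+1)=Fx_d(k)+D_d(u(k+1)-u(k)),\quad y(k)=x_s(k)+\Psi x_d(k).$$ At time $0$: $u(0)=0$, $x_s(0)=0$, $x_d(0)=0$. Predictions. Let $m\ge 1$ be an integer (input horizon). At each time step $k\ge 1$, a sequence of moves $\Delta u_k=(\Delta u(0|k),\dots,\Delta u(m-1|k))\in(\mathbb{R}^{n_u})^m$ is considered, with $\Delta u(j|k)=0$ for $j\ge m$. Starting from the actual values $u(k-1)$, $x_s(k-1)$, $x_d(k-1)$ (assigned to index $j=-1$), the predictions for $j\ge 0$ are $$x_s(j|k)=x_s(j-1|k)+D_0\Delta u(j|k),\quad x_d(j|k)=Fx_d(j-1|k)+D_d\Delta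 u(j|k),\quad y(j|k)=x_s(j|k)+\Psi x_d(j|k),$$ and $u(j|k)=u(k-1)+\sum_{i=0}^{j}\Delta u(i|k)$. Optimization problem. Let $r\in\mathbb{R}^{n_y}$ be the output set-point, $e(j|k)=y(j|k)-r$, $\delta_k\in\mathbb{R}^{n_y}$ a slack vector, and let $Q\in\mathbb{R}^{n_y\times n_y}$, $R\in\mathbb{R}^{n_u\times n_u}$, $S\in\mathbb{R}^{n_y\times n_y}$ be positive definite. The cost is $$V_k=\sum_{j=0}^{\infty}[e(j|k)-\delta_k]^TQ[e(j|k)-\delta_k]+\sum_{j=0}^{m-1}\Delta u(j|k)^TR\,\Delta u(j|k)+\delta_k^TS\delta_k .$$ At each $k\ge 1$, $V_k$ is minimized over $(\Delta u_k,\delta_k)$ subject to $x_s(m-1|k)-\delta_k-r=0$, $u(k-1)+\sum_{j=0}^{i}\Delta u(j|k)\in\mathbb{U}$ for $0\le i<m$, and $\Delta u(j|k)\in\Delta\mathbb{U}$ for $0\le j<m$, where $\mathbb{U}$ and $\Delta\mathbb{U}$ are fixed rectangles in $\mathbb{R}^{n_u}$ containing the origin. The solution is unique; it is denoted $\Delta u_k^*,\delta_k^*$, the corresponding optimal cost is $V_k^*$, and starred quantities $u^*,x_s^*,x_d^*,y^*,e^*$ are the ones obtained from it. Closed loop. Only the first move is implemented: the actual input, state and output at time $k$ are $u(k)=u^*(0|k)=\sum_{\ell=1}^{k}\Delta u^*(0|\ell)$, $x_s(k)=x_s^*(0|k)$, $x_d(k)=x_d^*(0|k)$, $y(k)=y^*(0|k)$,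 and the problem is then solved again at time $k+1$.
   Formalization: The rectangle ΔU of admissible moves is assumed to contain the origin in its interior, not merely to contain it; with the origin on its boundary the claim fails (e.g. scalar D_0=1, ΔU=[0,1], r=-1/2 gives V_k^*=S/4 for all k). *)

(* Defs.v *)
From mathcomp Require Import all_boot all_order all_algebra.
From mathcomp Require Import all_classical all_reals all_analysis.
From mathcomp Require Import complex.

Set Implicit Arguments.
Unset Strict Implicit.
Unset Printing Implicit Defensive.

Import Order.TTheory GRing.Theory Num.Theory.
Import numFieldNormedType.Exports.

Local Open Scope ring_scope.
Local Open Scope classical_set_scope.
Local Open Scope complex_scope.

(* [Normc.normc] is the modulus as a real number ([`|z|] lives in
   [R[i]]).  The set is finite, and [sup set0 = 0] covers [n = 0]. *)
Definition spectral_radius (R : realType) n (A : 'M[R[i]]_n) : R :=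
  sup [set Normc.normc z | z in [set z | eigenvalue A z]].

Definition quad (R : realType) n (A : 'M[R]_n) (v : 'cV[R]_n) : R :=
  (v^T *m A *m v) 0 0.

Definition posdef (R : realType) n (A : 'M[R]_n) : Prop :=
  A^T = A /\ forall v : 'cV[R]_n, v != 0 -> 0 < quad A v.

Definition rectangle (R : realType) n (lo hi : 'cV[R]_n) : set 'cV[R]_n :=
  [set v | forall i, lo i 0 <= v i 0 <= hi i 0].

Section Model.
Variables (R : realType) (nd ny nu : nat).

Record system := System {
  sysF : 'M[R[i]]_nd ;
  sysD0 : 'M[R]_(ny, nu) ;
  sysDd : 'M[R[i]]_(nd, nu) ;
  sysPsi : 'M[R]_(ny, nd)
}.

Record state := State {
  inp : 'cV[R]_nu ;
  xs : 'cV[R]_ny ;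
  xd : 'cV[R[i]]_nd
}.

Definition state0 : state := State 0 0 0.

Variable P : system.

Definition step (x : state) (du : 'cV[R]_nu) : state :=
  State (inp x + du)
        (xs x + sysD0 P *m du)
        (sysF P *m xd x + sysDd P *m map_mx (real_complex R) du).

Fixpoint run (x : state) (du : nat -> 'cV[R]_nu) (j : nat) : state :=
  if j is j'.+1 then step (run x du j') (du j') else x.

Definition dyn_output (x : state) : 'cV[R[i]]_ny :=
  map_mx (real_complex R) (sysPsi P) *m xd x.

(* The output is real along every trajectory starting at rest, although [F]
   and [D_d] are complex (complex modes occur in conjugate pairs). *)
Definition real_output : Prop :=
  forall (du : nat -> 'cV[R]_nu) (k : nat) (i : 'I_ny),
    complex.Im (dyn_output (run state0 du k) i 0) = 0.

(* Under [real_output], taking real parts is the identity. *)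
Definition output (x : state) : 'cV[R]_ny :=
  xs x + map_mx (@complex.Re R) (dyn_output x).

Section Horizon.
Variable m : nat.

Definition move (du : 'I_m -> 'cV[R]_nu) (j : nat) : 'cV[R]_nu :=
  oapp du 0 (insub j).

(* State predicted at index [j >= 0]; [x] is the actual state at time [k-1],
   which the predictions assign to index [-1]. *)
Definition predict (x : state) (du : 'I_m -> 'cV[R]_nu) (j : nat) : state :=
  run x (move du) j.+1.

Section Problem.
Variables (r : 'cV[R]_ny) (Q : 'M[R]_ny) (Rw : 'M[R]_nu) (S : 'M[R]_ny).
Variables (U dU : set 'cV[R]_nu).

(* Extended-real valued, since the infinite sum may diverge when the terminal
   constraint fails. *)
Definition cost (x : state) (du : 'I_m -> 'cV[R]_nu) (delta : 'cV[R]_ny) :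
    \bar R :=
  (\sum_(0 <= j <oo) (quad Q (output (predict x du j) - r - delta))%:E
   + (\sum_(j < m) quad Rw (du j))%:E
   + (quad S delta)%:E)%E.

Definition feasible (x : state) (du : 'I_m -> 'cV[R]_nu) (delta : 'cV[R]_ny) :
    Prop :=
  [/\ xs (predict x du m.-1) - delta - r = 0,
      forall i : 'I_m, U (inp x + \sum_(j < m | (j <= i)%N) du j) &
      forall j : 'I_m, dU (du j)].

Definition optimal (x : state) (du : 'I_m -> 'cV[R]_nu) (delta : 'cV[R]_ny) :
    Prop :=
  feasible x du delta /\
  forall du' delta', feasible x du' delta' ->
    (cost x du delta <= cost x du' delta')%E.

(* [x k] is the actual state at time [k]; [(du k, delta k)] is the solution of
   the problem at time [k >= 1] (the values at [k = 0] are irrelevant). *)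
Definition closed_loop (x : nat -> state) (du : nat -> 'I_m -> 'cV[R]_nu)
    (delta : nat -> 'cV[R]_ny) : Prop :=
  x 0%N = state0 /\
  forall k, optimal (x k) (du k.+1) (delta k.+1) /\
            x k.+1 = predict (x k) (du k.+1) 0.

End Problem.
End Horizon.
End Model.

(* Main.v *)
Require Import Defs.
From HB Require Import structures.
From mathcomp Require Import all_boot all_order all_algebra.
From mathcomp Require Import all_classical all_reals all_analysis.
From mathcomp Require Import complex ring lra.

Set Implicit Arguments.
Unset Strict Implicit.
Unset Printing Implicit Defensive.

Import Order.TTheory GRing.Theory Num.Theory.
Import numFieldNormedType.Exports.

Local Open Scope ring_scope.
Local Open Scope classical_set_scope.

(** The closed loop drives the cost to zero for every positive definite slack
    weight [S]; the theorem is proved with [S = Q].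

    Write [V k] for the optimal cost.  Dropping the implemented move and padding
    the horizon with a zero move keeps the terminal constraint, so [V] decreases
    by at least the first tracking term plus the first move penalty
    ([value_step]).  Hence [V] converges, the implemented moves tend to zero,
    and so does the tracking term [y - r - delta].  The dynamic state, a stable
    system driven by those moves, tends to zero too ([contracting_norm],
    [perturbed_contraction_cvg0]).  Therefore the slack is asymptotically
    [x_s - r], and [V k >= delta^T S delta] bounds [|x_s - r|_S ^ 2] from above
    up to a vanishing error.

    In the other direction, [x_s = D_0 u] along the closed loop, so a single
    move by [e * (u_r - u)] shrinks [x_s - r = D_0 (u - u_r)] by the factor
    [1 - e].  For small [e] it is feasible, and with the slack
    [(1 - e) (x_s - r)] it costs [(1 - e)^2 |x_s - r|_S ^ 2 + O(e^2)] plus a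
    vanishing term, with a constant that is uniform because the input rectangle
    is bounded ([value_descent]).  The limit [l] of [V] then satisfies
    [l <= (1 - e) l + O(e^2)]: the gain is of first order in [e] and the price
    of second order, which forces [l = 0] ([quadratic_descent_cvg0]).  Since
    only the image [D_0 (u - u_r)] matters, [D_0] may be any matrix. *)

(** * The entrywise 1-norm of complex matrices *)

Definition l1norm (R : realType) m n (A : 'M[R[i]]_(m, n)) : R :=
  \sum_i \sum_j Normc.normc (A i j).

Section L1norm.
Variable R : realType.
Implicit Types (m n p : nat).

Lemma normc_ge0 (z : R[i]) : 0 <= Normc.normc z.
Proof. by case: z => a b; exact: sqrtr_ge0. Qed.

Lemma normc_real (a : R) : Normc.normc (real_complex R a) = `|a|.
Proof. by rewrite /Normc.normc/= expr0n addr0 sqrtr_sqr. Qed.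

Lemma normc_ge_absRe (z : R[i]) : `|complex.Re z| <= Normc.normc z.
Proof. by rewrite -lecR; exact: normc_ge_Re. Qed.

Lemma l1norm_ge0 m n (A : 'M[R[i]]_(m, n)) : 0 <= l1norm A.
Proof. by do 2!apply: sumr_ge0 => ? _; exact: normc_ge0. Qed.

Lemma normc_le_l1norm m n (A : 'M[R[i]]_(m, n)) i j :
  Normc.normc (A i j) <= l1norm A.
Proof.
rewrite /l1norm (bigD1 i)//= (bigD1 j)//= -addrA lerDl addr_ge0//.
  by apply: sumr_ge0 => ? _; exact: normc_ge0.
by do 2!apply: sumr_ge0 => ? _; exact: normc_ge0.
Qed.

Lemma l1norm_eq0 m n (A : 'M[R[i]]_(m, n)) : l1norm A = 0 -> A = 0.
Proof.
move=> A0; apply/matrixP => i j; rewrite mxE; apply: Normc.eq0_normc.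
by apply/eqP; rewrite eq_le normc_ge0 andbT -A0 normc_le_l1norm.
Qed.

Lemma ler_l1normD m n (A B : 'M[R[i]]_(m, n)) :
  l1norm (A + B) <= l1norm A + l1norm B.
Proof.
rewrite /l1norm -big_split ler_sum//= => i _.
rewrite -big_split ler_sum//= => j _.
by rewrite mxE; exact: le_normcD.
Qed.

Lemma l1normZ m n (a : R[i]) (A : 'M[R[i]]_(m, n)) :
  l1norm (a *: A) = Normc.normc a * l1norm A.
Proof.
rewrite /l1norm mulr_sumr; apply: eq_bigr => i _.
rewrite mulr_sumr; apply: eq_bigr => j _.
by rewrite mxE Normc.normcM.
Qed.

Lemma ler_normc_sum (I : finType) (f : I -> R[i]) :
  Normc.normc (\sum_i f i) <= \sum_i Normc.normc (f i).
Proof.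
elim/big_ind2: _ => //; first by rewrite Normc.normc0.
by move=> x1 x2 y1 y2 h1 h2; rewrite (le_trans (le_normcD _ _))// lerD.
Qed.

Lemma ler_l1normM m n p (A : 'M[R[i]]_(m, n)) (B : 'M[R[i]]_(n, p)) :
  l1norm (A *m B) <= l1norm A * l1norm B.
Proof.
rewrite /l1norm mulr_suml ler_sum// => i _.
apply: (@le_trans _ _
  (\sum_k \sum_j Normc.normc (A i j) * Normc.normc (B j k))).
  apply: ler_sum => k _; rewrite mxE (le_trans (ler_normc_sum _))//.
  by apply: ler_sum => j _; rewrite Normc.normcM.
rewrite exchange_big/= mulr_suml ler_sum// => j _.
rewrite -mulr_sumr ler_wpM2l ?normc_ge0//.
rewrite [leRHS](bigD1 j)//= lerDl sumr_ge0// => l _.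
by apply: sumr_ge0 => ? _; exact: normc_ge0.
Qed.

End L1norm.

(** * Powers of a matrix of spectral radius smaller than one *)

Section Stability.
Variable R : realType.

Lemma eigenvalue_le_l1norm n (A : 'M[R[i]]_n) (z : R[i]) :
  eigenvalue A z -> Normc.normc z <= l1norm A.
Proof.
move=> /eigenvalueP[v vA v0].
have v_gt0 : 0 < l1norm v.
  rewrite lt_def l1norm_ge0 andbT; apply: contraNneq v0 => v0.
  by apply/eqP; exact: l1norm_eq0.
by rewrite -(ler_pM2l v_gt0) mulrC -l1normZ -vA ler_l1normM.
Qed.

Lemma eigenvalue_le_spectral_radius n (A : 'M[R[i]]_n) (z : R[i]) :
  eigenvalue A z -> Normc.normc z <= spectral_radius A.
Proof.
move=> Az; apply: ub_le_sup; last by exists z.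
by exists (l1norm A) => _ [w Aw <-]; exact: eigenvalue_le_l1norm.
Qed.

(** Multiplying by one linear factor at a time: [s j = A ^+ j * p(A)] solves
    [s j.+1 = z s j + A ^+ j * (A - z) p(A)], and summing the norms gives
    [(1 - |z|) * (sum of |s j|) <= |s 0| + (sum of the forcing terms)]. *)
Lemma summable_linear_factor n (A : 'M[R[i]]_n.+1) (p : {poly R[i]}) (z : R[i])
    (B : R) :
  Normc.normc z < 1 ->
  (forall N, \sum_(j < N) l1norm (A ^+ j * horner_mx A (('X - z%:P) * p)) <= B) ->
  forall N, \sum_(j < N) l1norm (A ^+ j * horner_mx A p)
            <= (l1norm (horner_mx A p) + B) / (1 - Normc.normc z).
Proof.
move=> z1 hB N.
pose s (j : nat) : R := l1norm (A ^+ j * horner_mx A p).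
have sS j : s j.+1 <= Normc.normc z * s j
    + l1norm (A ^+ j * horner_mx A (('X - z%:P) * p)).
  rewrite -l1normZ (le_trans _ (ler_l1normD _ _))// le_eqVlt; apply/orP; left.
  apply/eqP; congr l1norm.
  rewrite rmorphM rmorphB/= horner_mx_X horner_mx_C mulrBl mulrBr exprSr.
  have -> : z%:M * horner_mx A p = z *: horner_mx A p by exact: mul_scalar_mx.
  by rewrite mulrA -scalerAr addrC subrK.
have s_ge0 j : 0 <= s j by exact: l1norm_ge0.
rewrite ler_pdivlMr ?subr_gt0// mulrBr mulr1 lerBlDr.
apply: (@le_trans _ _ (\sum_(j < N.+1) s j)).
  by rewrite big_ord_recr/= lerDl.
rewrite big_ord_recl {1}/s expr0 mul1r -addrA lerD2l.
apply: (@le_trans _ _ (\sum_(j < N) (l1norm (A ^+ j * horner_mx A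
    (('X - z%:P) * p)) + Normc.normc z * s j))).
  by apply: ler_sum => j _; rewrite addrC; exact: sS.
by rewrite big_split/= -mulr_sumr [_ * \sum_(i < N) _]mulrC; apply: lerD => //; exact: hB.
Qed.

(** By the Cayley-Hamilton theorem the product of the factors [A - z], over the
    roots [z] of the characteristic polynomial, is zero; peeling the factors
    off one by one leaves the powers of [A] themselves. *)
Lemma summable_powers n (A : 'M[R[i]]_n.+1) : spectral_radius A < 1 ->
  exists B, forall N, \sum_(j < N) l1norm (A ^+ j) <= B.
Proof.
move=> A1.
have [rs Drs] := closed_field_poly_normal (char_poly A).
rewrite (monicP (char_poly_monic A)) scale1r in Drs.
have rs1 : all (fun z => Normc.normc z < 1) rs.
  apply/allP => z zrs; apply: le_lt_trans A1.
  apply: eigenvalue_le_spectral_radius.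
  by rewrite eigenvalue_root_char Drs root_prod_XsubC.
have [B hB] : exists B, forall N,
    \sum_(j < N) l1norm (A ^+ j * horner_mx A (\prod_(z <- rs) ('X - z%:P))) <= B.
  exists 0 => N; rewrite -Drs Cayley_Hamilton big1// => j _.
  by rewrite mulr0 /l1norm big1// => a _; rewrite big1// => b _; rewrite mxE Normc.normc0.
elim: rs rs1 {Drs} B hB => [|z rs ih]/=.
  move=> _ B hB; exists B => N; apply: le_trans (hB N).
  by rewrite big_nil ler_sum// => j _; rewrite rmorph1 mulr1.
move=> /andP[z1 rs1] B; rewrite big_cons => hB.
apply: (ih rs1); exact: summable_linear_factor z1 hB.
Qed.

(** A norm for which [A] is a contraction.  Some power [A ^+ M] has norm at most
    [1/2]; the sum [nu z] of the norms of [z, A z, .., A ^+ M.-1 z] then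
    telescopes to [nu (A z) = nu z - |z| + |A ^+ M z| <= nu z - |z| / 2]. *)
Lemma contracting_norm n (A : 'M[R[i]]_n) : spectral_radius A < 1 ->
  exists (nu : 'cV[R[i]]_n -> R) (rho c : R),
    [/\ 0 <= rho < 1, 0 <= c,
        forall z, l1norm z <= nu z <= c * l1norm z,
        forall z w, nu (z + w) <= nu z + nu w &
        forall z, nu (A *m z) <= rho * nu z].
Proof.
case: n A => [|n] A A1.
  have l0 (z : 'cV[R[i]]_0) : l1norm z = 0 by rewrite /l1norm big_ord0.
  exists (@l1norm R 0 1), 0, 0; split => // [|z|z w|z];
    by rewrite ?lexx ?ltr01// !l0 ?(mul0r, mulr0, addr0) ?lexx.
have [B0 hB0] := summable_powers A1.
have B0_ge0 : 0 <= B0 by have := hB0 0; rewrite big_ord0.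
pose B := 1 + B0.
have B_gt0 : 0 < B by rewrite /B; lra.
have [M AM] : exists M, l1norm (A ^+ M.+1) <= 2^-1.
  apply/not_existsP => big.
  pose N := (Num.truncn (2 * B0)).+1.
  have N_gt : 2 * B0 < N%:R by exact: truncnS_gt.
  have := hB0 N.+1; rewrite big_ord_recl/=.
  suff : N%:R * 2^-1 <= \sum_(i < N) l1norm (A ^+ (bump 0 i)).
    by have := l1norm_ge0 (A ^+ 0); lra.
  rewrite mulrC mulr_natr -[N in _ *+ N]card_ord -sumr_const ler_sum// => i _.
  by rewrite leNgt; apply/negP => /ltW; exact: big.
pose nu (z : 'cV[R[i]]_n.+1) := \sum_(j < M.+1) l1norm (A ^+ j *m z).
exists nu, (1 - (2 * B)^-1), B.
have nu_ge z : l1norm z <= nu z.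
  rewrite /nu big_ord_recl expr0 mul1mx lerDl sumr_ge0// => j _.
  exact: l1norm_ge0.
have nu_le z : nu z <= B * l1norm z.
  apply: (@le_trans _ _ (B0 * l1norm z)).
    apply: le_trans (ler_wpM2r (l1norm_ge0 z) (hB0 M.+1)).
    by rewrite mulr_suml ler_sum// => j _; exact: ler_l1normM.
  by rewrite ler_wpM2r ?l1norm_ge0// /B; lra.
split.
- have B1 : 1 <= 2 * B by rewrite /B; lra.
  by rewrite subr_ge0 invf_le1 ?(lt_le_trans ltr01 B1)//= B1/= ltrBlDr ltrDl
    invr_gt0 (lt_le_trans ltr01 B1).
- exact: ltW.
- by move=> z; rewrite nu_ge nu_le.
- move=> z w; rewrite /nu -big_split ler_sum//= => j _.
  by rewrite mulmxDr ler_l1normD.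
- move=> z.
  have tele : nu (A *m z) + l1norm z = nu z + l1norm (A ^+ M.+1 *m z).
    have <- : \sum_(j < M.+2) l1norm (A ^+ j *m z) = nu z + l1norm (A ^+ M.+1 *m z).
      by rewrite big_ord_recr.
    rewrite big_ord_recl expr0 mul1mx addrC; congr (_ + _).
    by apply: eq_bigr => j _; rewrite mulmxA lift0 exprSr.
  have half : l1norm (A ^+ M.+1 *m z) <= 2^-1 * l1norm z.
    by rewrite (le_trans (ler_l1normM _ _))// ler_wpM2r ?l1norm_ge0.
  have : (2 * B)^-1 * nu z <= 2^-1 * l1norm z.
    by rewrite invfM -mulrA ler_pM2l ?invr_gt0// mulrC ler_pdivrMr// mulrC nu_le.
  by rewrite mulrBl mul1r; lra.
Qed.

End Stability.

(** * Positive definite quadratic forms *)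

Section QuadraticForms.
Variables (R : realType) (n : nat).
Implicit Types (A : 'M[R]_n) (v w : 'cV[R]_n).

Definition polar A v w : R := (v^T *m A *m w) 0 0.

Lemma quad0 A : quad A 0 = 0.
Proof. by rewrite /quad mulmx0 mxE. Qed.

Lemma quadZ A a v : quad A (a *: v) = a ^+ 2 * quad A v.
Proof.
by rewrite /quad [(a *: v)^T]linearZ/= -!scalemxAl -scalemxAr scalerA mxE expr2.
Qed.

Lemma polarC A v w : A^T = A -> polar A w v = polar A v w.
Proof.
move=> At; rewrite /polar; have -> : (w^T *m A *m v) 0 0 = (w^T *m A *m v)^T 0 0.
  by rewrite [RHS]mxE.
by rewrite !trmx_mul trmxK At mulmxA.
Qed.

Lemma quadD A v w : A^T = A ->
  quad A (v + w) = quad A v + 2 * polar A v w + quad A w.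
Proof.
move=> At; have := polarC v w At; rewrite /polar /quad [(v + w)^T]linearD/= => wv.
rewrite !mulmxDl !mulmxDr mxE [X in X + _]mxE [X in _ + X]mxE wv; ring.
Qed.

Lemma polarZl A a v w : polar A (a *: v) w = a * polar A v w.
Proof. by rewrite /polar [(a *: v)^T]linearZ/= -!scalemxAl mxE. Qed.

Lemma polarZr A a v w : polar A v (a *: w) = a * polar A v w.
Proof. by rewrite /polar -!scalemxAr mxE. Qed.

Lemma posdef_ge0 A v : posdef A -> 0 <= quad A v.
Proof.
by move=> [_ A0]; have [->|/A0/ltW//] := eqVneq v 0; rewrite quad0.
Qed.

Lemma posdef_Cauchy_Schwarz A v w : posdef A ->
  polar A v w ^+ 2 <= quad A v * quad A w.
Proof.
move=> pA; have [At A0] := pA.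
have [->|v0] := eqVneq v 0.
  by rewrite quad0 /polar trmx0 !mul0mx mxE expr0n mul0r.
have qv := A0 _ v0.
have := posdef_ge0 (quad A v *: w + (- polar A v w) *: v) pA.
rewrite quadD// !quadZ polarZl polarZr (polarC v w At) => h.
rewrite -subr_ge0 -(pmulr_rge0 _ qv); apply: le_trans h _.
rewrite le_eqVlt; apply/orP; left; apply/eqP; ring.
Qed.

Lemma posdef_young A (eta : R) v w : posdef A -> 0 < eta ->
  quad A (v + w) <= (1 + eta) * quad A v + (1 + eta^-1) * quad A w.
Proof.
move=> pA eta0; have [At _] := pA.
have := posdef_ge0 (eta *: v + (-1) *: w) pA.
rewrite !quadD// !quadZ polarZl polarZr => h.
have : 0 <= eta^-1 * (eta ^+ 2 * quad A v + 2 * (eta * (-1 * polar A v w)) +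
                (-1) ^+ 2 * quad A w) by rewrite mulr_ge0// invr_ge0 ltW.
have -> : eta^-1 * (eta ^+ 2 * quad A v + 2 * (eta * (-1 * polar A v w)) +
  (-1) ^+ 2 * quad A w) = eta * quad A v - 2 * polar A v w + eta^-1 * quad A w.
  by field; rewrite gt_eqF.
by lra.
Qed.

Lemma quad_le_l1norm A : exists2 c, 0 <= c & forall z : 'cV[R[i]]_n,
  quad A (map_mx (@complex.Re R) z) <= c * l1norm z ^+ 2.
Proof.
exists (\sum_j \sum_i `|A i j|) => [|z].
  by do 2!apply: sumr_ge0 => ? _.
rewrite /quad mxE mulr_suml ler_sum// => j _.
rewrite !mxE mulr_suml mulr_suml ler_sum// => i _.
rewrite !mxE (le_trans (ler_norm _))// !normrM mulrAC mulrC expr2.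
rewrite ler_wpM2l//.
by apply: ler_pM => //; apply: le_trans (normc_ge_absRe _) (normc_le_l1norm _ _ _).
Qed.

(** Each coordinate is [v i = polar A (A^-1 e_i) v], to which the
    Cauchy-Schwarz inequality applies. *)
Lemma posdef_coercive A : posdef A -> exists2 c, 0 <= c & forall v,
  l1norm (map_mx (real_complex R) v) ^+ 2 <= c * quad A v.
Proof.
move=> pA; have [At A0] := pA.
have Au : A \in unitmx.
  rewrite -row_free_unit -kermx_eq0; apply/eqP/row_matrixP => i.
  apply/eqP; rewrite row0; apply: contraT => k0.
  have k0' : (row i (kermx A))^T != 0.
    by apply: contraNneq k0 => /(congr1 trmx); rewrite trmxK trmx0 => ->.
  have := A0 _ k0'; rewrite /quad trmxK -row_mul mulmx_ker row0 mul0mx mxE.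
  by rewrite ltxx.
pose e (i : 'I_n) : 'cV[R]_n := (invmx A) *m delta_mx i 0.
have eE i v : v i 0 = polar A (e i) v.
  rewrite /polar /e trmx_mul trmx_inv At mulmxKV// trmx_delta.
  by rewrite -rowE mxE.
exists ((\sum_i Num.sqrt (quad A (e i))) ^+ 2) => [|v]; first exact: sqr_ge0.
have s_ge0 : 0 <= \sum_i Num.sqrt (quad A (e i)).
  by apply: sumr_ge0 => i _; exact: sqrtr_ge0.
rewrite -[quad A v in leRHS]sqr_sqrtr ?posdef_ge0// -exprMn.
rewrite ler_sqr ?nnegrE ?l1norm_ge0// ?mulr_ge0 ?sqrtr_ge0//.
rewrite /l1norm mulr_suml ler_sum// => i _.
rewrite big_ord1 mxE normc_real eE -sqrtrM ?posdef_ge0//.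
by rewrite -sqrtr_sqr ler_wsqrtr// posdef_Cauchy_Schwarz.
Qed.

End QuadraticForms.

(** * Predicted trajectories, candidate moves and their costs *)

Section Trajectories.
Variables (R : realType) (nd ny nu : nat) (P : system R nd ny nu).
Implicit Types (x : state R nd ny nu) (du : nat -> 'cV[R]_nu).

Lemma run_shift x du j :
  run P (step P x (du 0)) (fun i => du i.+1) j = run P x du j.+1.
Proof. by elim: j => [//|j ih]; rewrite [LHS]/= ih. Qed.

Lemma eq_run x du du' : du =1 du' -> run P x du =1 run P x du'.
Proof. by move=> e; elim=> [//|j ih]; rewrite /= ih e. Qed.

Lemma inp_run x du n : inp (run P x du n) = inp x + \sum_(i < n) du i.
Proof.
elim: n => [|n ih]; first by rewrite big_ord0 addr0.
by rewrite /= ih big_ord_recr addrA.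
Qed.

Lemma xs_run x du n :
  xs (run P x du n) = xs x + sysD0 P *m \sum_(i < n) du i.
Proof.
elim: n => [|n ih]; first by rewrite big_ord0 mulmx0 addr0.
by rewrite /= ih big_ord_recr mulmxDr addrA.
Qed.

End Trajectories.

Lemma nneseries_head (R : realType) (f : nat -> \bar R) :
  (forall k, 0 <= f k)%E ->
  (\sum_(0 <= k <oo) f k = f 0%N + \sum_(0 <= k <oo) f k.+1)%E.
Proof.
move=> f0; rewrite (@nneseries_recl _ xpredT)//; congr (_ + _)%E.
by rewrite -(nneseries_addn 1 f0); apply: eq_eseriesr => k _; rewrite addn1.
Qed.

Section Candidates.
Variables (R : realType) (nd ny nu : nat) (P : system R nd ny nu) (m : nat).
Variables (r : 'cV[R]_ny) (Q : 'M[R]_ny) (Rw : 'M[R]_nu) (S : 'M[R]_ny).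
Variables (U dU : set 'cV[R]_nu).
Implicit Types (x : state R nd ny nu) (du : 'I_m -> 'cV[R]_nu).

Lemma move_ord du (i : 'I_m) : move du i = du i.
Proof. by rewrite /move valK. Qed.

Lemma move_out du j : (m <= j)%N -> move du j = 0.
Proof. by move=> mj; rewrite /move insubF// ltnNge mj. Qed.

Lemma inp_predict x du (i : 'I_m) :
  inp (predict P x du i) = inp x + \sum_(j < m | (j <= i)%N) du j.
Proof.
rewrite /predict inp_run; congr (_ + _).
rewrite (big_ord_widen m (move du)) ?ltn_ord//.
by apply: eq_big => j // _; exact: move_ord.
Qed.

(** The moves left over one step later: the first one is dropped, and the
    horizon is completed by a zero move. *)
Definition shift_moves du : 'I_m -> 'cV[R]_nu := fun j => move du j.+1.

Lemma move_shift du j : move (shift_moves du) j = move du j.+1.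
Proof.
have [jm|mj] := ltnP j m.
  by rewrite (move_ord _ (Ordinal jm)).
by rewrite !move_out// ltnW.
Qed.

Lemma predict_shift x du j :
  predict P (predict P x du 0) (shift_moves du) j = predict P x du j.+1.
Proof.
rewrite /predict -(run_shift P x (move du) j.+1).
by apply: eq_run => i; exact: move_shift.
Qed.

(** The predicted input and static state, which the constraints concern, are
    constant from index [m.-1] on, since all later moves vanish. *)
Lemma feasible_shift x du delta : (0 < m)%N -> dU 0 ->
  feasible P r U dU x du delta ->
  feasible P r U dU (predict P x du 0) (shift_moves du) delta.
Proof.
move=> m0 dU0 [xsT inU indU]; split.
- move: xsT; rewrite predict_shift /predict prednK// [run _ _ _ m.+1]/=.
  by rewrite [xs (step _ _ _)]/= move_out// mulmx0 addr0.
- move=> i; rewrite -inp_predict predict_shift.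
  have [im|mi] := ltnP i.+1 m.
    by rewrite (inp_predict x du (Ordinal im)).
  rewrite /predict inp_run big_ord_recr/= move_out// addr0.
  by rewrite -(inp_run P x (move du) i.+1) -/(predict P x du i) inp_predict.
- move=> j; rewrite /shift_moves; have [jm|mj] := ltnP j.+1 m.
    by rewrite (move_ord _ (Ordinal jm)).
  by rewrite move_out.
Qed.

Lemma cost_shift x du delta : (0 < m)%N -> posdef Q ->
  cost P r Q Rw S x du delta =
  ((quad Q (output P (predict P x du 0) - r - delta) + quad Rw (move du 0))%:E
   + cost P r Q Rw S (predict P x du 0) (shift_moves du) delta)%E.
Proof.
move=> m0 pQ.
have q0 k : (0 <= (quad Q (output P (predict P x du k) - r - delta))%:E)%E.
  by rewrite lee_fin posdef_ge0.
rewrite {1}/cost (nneseries_head q0).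
under [X in (_ + X + _ + _)%E]eq_eseriesr do rewrite -predict_shift.
have sumR : \sum_(j < m) quad Rw (du j) =
    quad Rw (move du 0) + \sum_(j < m) quad Rw (shift_moves du j).
  transitivity (\sum_(j < m.+1) quad Rw (move du j)); last by rewrite big_ord_recl.
  rewrite big_ord_recr/= move_out// quad0 addr0.
  by apply: eq_bigr => j _; rewrite move_ord.
rewrite sumR /cost !EFinD.
rewrite -!addeA; congr (_ + _)%E.
by rewrite addeCA.
Qed.

Lemma quad_slack_le_cost x du delta : posdef Q -> posdef Rw ->
  ((quad S delta)%:E <= cost P r Q Rw S x du delta)%E.
Proof.
move=> pQ pR; rewrite /cost leeDr// adde_ge0//.
  by apply: nneseries_ge0 => k _ _; rewrite lee_fin posdef_ge0.
by rewrite lee_fin sumr_ge0// => j _; rewrite posdef_ge0.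
Qed.

Definition single_move (d : 'cV[R]_nu) : 'I_m -> 'cV[R]_nu :=
  fun j => if val j == 0%N then d else 0.

Lemma move_single d j : (0 < m)%N ->
  move (single_move d) j = if j == 0%N then d else 0.
Proof.
move=> m0; have [jm|mj] := ltnP j m; first by rewrite (move_ord _ (Ordinal jm)).
by rewrite move_out// gtn_eqF// (leq_trans m0).
Qed.

Lemma sum_single d j : (0 < m)%N ->
  \sum_(i < j.+1) move (single_move d) i = d.
Proof.
move=> m0; rewrite big_ord_recl move_single//= big1 ?addr0// => i _.
by rewrite move_single.
Qed.

Lemma feasible_single x d delta : (0 < m)%N ->
  xs x + sysD0 P *m d - delta - r = 0 -> U (inp x + d) -> dU d -> dU 0 ->
  feasible P r U dU x (single_move d) delta.
Proof.
move=> m0 xsd Ud dUd dU0; split.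
- by rewrite /predict xs_run sum_single.
- by move=> i; rewrite -inp_predict /predict inp_run sum_single.
- by move=> j; rewrite -(move_ord _ j) move_single//; case: eqP.
Qed.

Section ContractingNorm.
Variables (N : 'cV[R[i]]_nd -> R) (rho : R).
Hypothesis rho01 : 0 <= rho < 1.
Hypothesis l1norm_le_N : forall z, l1norm z <= N z.
Hypothesis N_contract : forall z, N (sysF P *m z) <= rho * N z.

Lemma quad_dyn_output_le (A : 'M[R]_ny) : exists2 c, 0 <= c & forall x,
  quad A (map_mx (@complex.Re R) (dyn_output P x)) <= c * N (xd x) ^+ 2.
Proof.
have [c c0 hc] := quad_le_l1norm A.
exists (c * l1norm (map_mx (real_complex R) (sysPsi P)) ^+ 2) => [|x].
  by rewrite mulr_ge0 ?sqr_ge0.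
apply: le_trans (hc _) _; rewrite -mulrA ler_wpM2l// -exprMn.
have N0 : 0 <= N (xd x) by exact: le_trans (l1norm_ge0 _) (l1norm_le_N _).
rewrite ler_sqr ?nnegrE ?l1norm_ge0 ?mulr_ge0 ?l1norm_ge0//.
by rewrite (le_trans (ler_l1normM _ _))// ler_wpM2l ?l1norm_ge0.
Qed.

(** A single move reaches the terminal static state at once, so
    [x_s - r - delta] vanishes at every predicted index, and only the
    geometrically decaying dynamic output is left in the tracking cost. *)
Lemma cost_single_le : (0 < m)%N -> posdef Q -> exists2 c, 0 <= c &
  forall x d delta, xs x + sysD0 P *m d - delta - r = 0 ->
  (cost P r Q Rw S x (single_move d) delta <=
   (c * N (xd (step P x d)) ^+ 2 + quad Rw d + quad S delta)%:E)%E.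
Proof.
move=> m0 pQ; have [c c0 hc] := quad_dyn_output_le Q.
have [rho0 rho1] := andP rho01.
have rho2 : rho ^+ 2 < 1 by rewrite expr_lt1.
exists (c / (1 - rho ^+ 2)) => [|x d delta term].
  by rewrite divr_ge0// subr_ge0 ltW.
have N0 z : 0 <= N z by exact: le_trans (l1norm_ge0 _) (l1norm_le_N _).
set q0 := N (xd (step P x d)).
have NE j : N (xd (predict P x (single_move d) j)) <= rho ^+ j * q0.
  elim: j => [|j ih]; first by rewrite /predict/= move_single// mul1r.
  have -> : xd (predict P x (single_move d) j.+1) =
      sysF P *m xd (predict P x (single_move d) j).
    rewrite -[LHS]/(sysF P *m xd (predict P x (single_move d) j) +
      sysDd P *m map_mx (real_complex R) (move (single_move d) j.+1)).
    by rewrite move_single// map_mx0 mulmx0 addr0.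
  by rewrite exprS -mulrA (le_trans (N_contract _))// ler_wpM2l.
have quad_pred j :
    quad Q (output P (predict P x (single_move d) j) - r - delta) <=
    c * q0 ^+ 2 * (rho ^+ 2) ^+ j.
  have -> : output P (predict P x (single_move d) j) - r - delta =
      map_mx (@complex.Re R) (dyn_output P (predict P x (single_move d) j)).
    rewrite /output {1}/predict xs_run sum_single//.
    by rewrite -addrA addrAC -opprD [r + _]addrC opprD [_ + (_ - _)]addrA
      term add0r.
  apply: le_trans (hc _) _; rewrite -mulrA ler_wpM2l//.
  by rewrite -exprM mulnC exprM mulrC -exprMn ler_sqr ?nnegrE ?mulr_ge0
    ?exprn_ge0// N0.
rewrite 2!EFinD /cost; apply: leeD => //; apply: leeD; last first.
  rewrite lee_fin (bigD1 (Ordinal m0))//= big1 ?addr0// => j j0.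
  by rewrite /single_move ifN ?quad0.
apply: lime_le.
  by apply: is_cvg_nneseries => k _ _; rewrite lee_fin posdef_ge0.
apply: nearW => n; rewrite sumEFin lee_fin.
apply: le_trans (ler_sum _ (fun j _ => quad_pred j)) _.
rewrite -mulr_sumr [leRHS]mulrAC ler_wpM2l ?(mulr_ge0 c0 (sqr_ge0 _))//.
rewrite big_mkord -[leRHS]div1r ler_pdivlMr ?subr_gt0//.
by rewrite -opprB mulrN mulrC -subrX1 opprB lerBlDr lerDl exprn_ge0 ?sqr_ge0.
Qed.

End ContractingNorm.

End Candidates.

(** * Limits of real sequences *)

Section Sequences.
Variable R : realType.
Implicit Types (a b v : nat -> R).

Lemma perturbed_contraction_cvg0 a b (rho : R) : 0 <= rho < 1 ->
  (forall k, 0 <= a k) -> (forall k, a k.+1 <= rho * a k + b k) ->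
  b k @[k --> \oo] --> 0 -> a k @[k --> \oo] --> 0.
Proof.
move=> /andP[rho0 rho1] a0 ab b0; apply/cvgr0Pnorm_lt => e e0.
have e1 : 0 < e / 2 * (1 - rho) by rewrite mulr_gt0 ?divr_gt0// subr_gt0.
have /cvgr0Pnorm_lt/(_ _ e1)[K _ bK] := b0.
(* past [K] the forcing is so small that [e / 2] absorbs it *)
have aK j : a (j + K)%N <= rho ^+ j * a K + e / 2.
  elim: j => [|j ih]; first by rewrite add0n expr0 mul1r lerDl divr_ge0// ltW.
  have := ab (j + K)%N; have := bK (j + K)%N (leq_addl _ _).
  rewrite /= => /(le_lt_trans (ler_norm _)) bj aj.
  have := ler_wpM2l rho0 ih; rewrite addSn exprS -[rho * rho ^+ j * _]mulrA.
  by lra.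
have g0 : (fun j => a K * rho ^+ j) @ \oo --> (0 : R).
  by apply: cvg_geometric; rewrite ger0_norm.
have e2 : 0 < e / 2 by rewrite divr_gt0.
have /cvgr0Pnorm_lt/(_ _ e2)[J _ gJ] := g0.
exists (J + K)%N => // k /= Jk.
have Kk : (K <= k)%N by exact: leq_trans (leq_addl _ _) Jk.
have := gJ (k - K)%N; rewrite /= leq_subRL// addnC Jk => /(_ isT).
move=> /(le_lt_trans (ler_norm _)) gk.
by have := aK (k - K)%N; rewrite subnK// ger0_norm// mulrC; lra.
Qed.

Lemma cvg0_sqr a : a k @[k --> \oo] --> 0 -> (a k ^+ 2) @[k --> \oo] --> 0.
Proof.
by move=> a0; rewrite -[0 in X in _ --> X](mulr0 (0 : R)); under eq_fun do rewrite expr2;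
  apply: cvgM.
Qed.

Lemma cvg0_sqr_le a b : (forall k, 0 <= a k) -> (forall k, a k ^+ 2 <= b k) ->
  b k @[k --> \oo] --> 0 -> a k @[k --> \oo] --> 0.
Proof.
move=> a0 ab b0; apply/cvgr0Pnorm_lt => e e0.
have e2 : 0 < e ^+ 2 by rewrite exprn_gt0.
have /cvgr0Pnorm_lt/(_ _ e2) := b0.
apply: filterS => k /(le_lt_trans (ler_norm _)) bk.
by rewrite ger0_norm// -ltr_sqr ?nnegrE ?a0 ?(ltW e0)// (le_lt_trans (ab k) bk).
Qed.

(** The limit [l] satisfies [l <= (1 - e) l + C e ^ 2], that is [l <= C e], for
    all small [e]. *)
Lemma quadratic_descent_cvg0 v (C e0 : R) : 0 < e0 -> 0 <= C ->
  (forall k, 0 <= v k) -> (forall k, v k.+1 <= v k) ->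
  (forall e, 0 < e <= e0 -> exists2 w : nat -> R, w k @[k --> \oo] --> 0 &
     forall k, v k.+1 <= (1 - e) * v k + w k + C * e ^+ 2) ->
  v k @[k --> \oo] --> 0.
Proof.
move=> e0_gt0 C0 v0 vdec desc.
have cv : cvgn v.
  apply: nonincreasing_is_cvgn; first exact/nonincreasing_seqP.
  by exists 0 => _ [k _ <-].
pose l := limn v.
have vl : v @ \oo --> l by [].
have l0 : 0 <= l by apply: limr_ge => //; exact: nearW.
suff : l <= 0 by move=> l0'; rewrite -[0 in X in _ --> X](@le_anti _ _ l 0) ?l0 ?l0'.
rewrite leNgt; apply/negP => l_gt0.
(* small enough for [C e < l], which the limit inequality contradicts *)
pose e := Num.min e0 (l / (2 * (C + 1))).
have C1 : 0 < 2 * (C + 1) by lra.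
have e_gt0 : 0 < e by rewrite lt_min e0_gt0 divr_gt0.
have ee0 : 0 < e <= e0 by rewrite e_gt0 ge_min lexx.
have eC : e * (2 * (C + 1)) <= l by rewrite -ler_pdivlMr// ge_min lexx orbT.
have [w w0 hw] := desc e ee0.
have : l <= (1 - e) * l + 0 + C * e ^+ 2.
  have vSl : v k.+1 @[k --> \oo] --> l by rewrite (cvg_shiftS v).
  have rl : (1 - e) * v k + w k + C * e ^+ 2 @[k --> \oo] -->
      (1 - e) * l + 0 + C * e ^+ 2.
    apply: cvgD; last exact: cvg_cst.
    by apply: cvgD => //; apply: cvgM => //; exact: cvg_cst.
  by apply: (ler_cvg_to vSl rl); exact: nearW.
have -> : C * e ^+ 2 = e * (C * e) by ring.
rewrite addr0 mulrBl mul1r -addrA lerDl addrC subr_ge0 ler_pM2l// => lC.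
have : 0 <= e * C by rewrite mulr_ge0// ltW.
by nra.
Qed.

End Sequences.

(** * The closed loop *)

Section Rectangles.
Variables (R : realType) (n : nat).
Implicit Types (u v lo hi : 'cV[R]_n).

Lemma l1norm_real v : l1norm (map_mx (real_complex R) v) = \sum_i `|v i 0|.
Proof. by apply: eq_bigr => i _; rewrite big_ord1 mxE normc_real. Qed.

Lemma rectangle_convex lo hi u v (e : R) : 0 <= e <= 1 ->
  rectangle lo hi u -> rectangle lo hi v -> rectangle lo hi (u + e *: (v - u)).
Proof.
move=> /andP[e0 e1] hu hv i; have /andP[ul uh] := hu i; have /andP[vl vh] := hv i.
by rewrite !mxE; apply/andP; split; nra.
Qed.

Lemma rectangle_diff_le lo hi u v i : rectangle lo hi u -> rectangle lo hi v ->
  `|(v - u) i 0| <= hi i 0 - lo i 0.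
Proof.
move=> hu hv; have /andP[ul uh] := hu i; have /andP[vl vh] := hv i.
by rewrite !mxE ler_norml; apply/andP; split; lra.
Qed.

(** Zero is interior to the rectangle, so one factor [e0] shrinks a whole bounded
    set into it; this is what makes small steps admissible uniformly in time. *)
Lemma rectangle_absorbs lo hi (W : R) : 0 <= W ->
  (forall i, lo i 0 < 0 < hi i 0) ->
  exists2 e0 : R, 0 < e0 <= 1 & forall e v, 0 <= e <= e0 ->
    (forall i, `|v i 0| <= W) -> rectangle lo hi (e *: v).
Proof.
move=> W0 lh; have W1 : 0 < 1 + W by lra.
pose g i := Num.min (- lo i 0) (hi i 0).
exists (\big[Num.min/1]_i (g i / (1 + W))).
  rewrite bigmin_le_id andbT; apply/bigmin_gtP; split => // i _.
  by rewrite divr_gt0// lt_min oppr_gt0; exact: lh.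
move=> e v /andP[e0 ee0] vW i.
have eg : e * (1 + W) <= g i.
  by rewrite -ler_pdivlMr// (le_trans ee0)// bigmin_le_cond.
have : `|e * v i 0| <= g i.
  rewrite normrM ger0_norm//; apply: le_trans eg; rewrite ler_wpM2l//.
  by rewrite (le_trans (vW i))// lerDr.
by rewrite le_min !ler_norml mxE opprK => /andP[/andP[-> _] /andP[_ ->]].
Qed.

End Rectangles.

Section ClosedLoop.
Variables (R : realType) (nd ny nu : nat) (P : system R nd ny nu) (m : nat).
Variables (Q : 'M[R]_ny) (Rw : 'M[R]_nu) (S : 'M[R]_ny) (r : 'cV[R]_ny).
Variables (umin umax dumin dumax ur : 'cV[R]_nu).
Hypothesis m_gt0 : (0 < m)%N.
Hypothesis posQ : posdef Q.
Hypothesis U0 : rectangle umin umax 0.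
Hypothesis dU_nbhs0 : forall i, dumin i 0 < 0 < dumax i 0.
Hypothesis U_ur : rectangle umin umax ur.
Hypothesis rE : r = sysD0 P *m ur.

Variables (x : nat -> state R nd ny nu) (du : nat -> 'I_m -> 'cV[R]_nu).
Variable delta : nat -> 'cV[R]_ny.
Hypothesis cl : closed_loop P r Q Rw S (rectangle umin umax)
  (rectangle dumin dumax) x du delta.

(** The optimal cost of the problem posed at time [k.+1], whose data are the
    state at time [k]. *)
Definition value k := cost P r Q Rw S (x k) (du k.+1) (delta k.+1).

Lemma dU0 : rectangle dumin dumax 0.
Proof. by move=> i; have /andP[/ltW a /ltW b] := dU_nbhs0 i; rewrite mxE a b. Qed.

Lemma closed_loop_step k : x k.+1 = step P (x k) (move (du k.+1) 0).
Proof. by have [_ /(_ k)[_ ->]] := cl. Qed.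

Lemma closed_loop_inp k : rectangle umin umax (inp (x k)).
Proof.
have [x0 h] := cl; case: k => [|k]; first by rewrite x0.
have [[[_ inU _] _] ->] := h k.
by have := inU (Ordinal m_gt0); rewrite -(inp_predict P).
Qed.

Lemma closed_loop_xs k : xs (x k) = sysD0 P *m inp (x k).
Proof.
elim: k => [|k ih]; first by have [-> _] := cl; rewrite mulmx0.
by rewrite closed_loop_step /= ih mulmxDr.
Qed.

(** The right-hand side exceeds the cost of the shifted moves by the first
    tracking term and the first move penalty, and the optimum at the next time
    is no worse than those moves. *)
Lemma value_step k :
  ((quad Q (output P (x k.+1) - r - delta k.+1)
    + quad Rw (move (du k.+1) 0))%:E + value k.+1 <= value k)%E.
Proof.
have [_ h] := cl.
have [[feas _] xk] := h k; have [[_ opt] _] := h k.+1.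
rewrite [leRHS](cost_shift _ _ _ _ _ _ _ m_gt0)// -xk leeD2l//.
by apply: opt; rewrite xk; apply: feasible_shift => //; exact: dU0.
Qed.

Lemma candidate_terminal k (e : R) :
  xs (x k) + sysD0 P *m (e *: (ur - inp (x k)))
    - (1 - e) *: (xs (x k) - r) - r = 0.
Proof.
rewrite -scalemxAr mulmxBr -rE -closed_loop_xs.
apply/matrixP => i j; rewrite !mxE; ring.
Qed.

Lemma candidate_feasible : exists2 e0 : R, 0 < e0 <= 1 &
  forall k e, 0 <= e <= e0 ->
  feasible P r (rectangle umin umax) (rectangle dumin dumax) (x k)
    (@single_move _ _ m (e *: (ur - inp (x k)))) ((1 - e) *: (xs (x k) - r)).
Proof.
pose W := \sum_i (umax i 0 - umin i 0).
have w0 i : 0 <= umax i 0 - umin i 0.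
  by have := U_ur i; rewrite subr_ge0 => /andP[]; exact: le_trans.
have W0 : 0 <= W by exact: sumr_ge0.
have [e0 /andP[e00 e01] he0] := rectangle_absorbs W0 dU_nbhs0.
exists e0 => [|k e /andP[e_ge0 e_le]]; first by rewrite e00.
apply: feasible_single => //.
- exact: candidate_terminal.
- apply: rectangle_convex => //; first by rewrite e_ge0 (le_trans e_le).
  exact: closed_loop_inp.
- apply: he0 => [|i]; first by rewrite e_ge0.
  apply: le_trans (rectangle_diff_le i (closed_loop_inp k) U_ur) _.
  by rewrite /W (bigD1 i)//= lerDl sumr_ge0.
- exact: dU0.
Qed.

(** The static part of the candidate costs exactly [(1 - e)^2 |x_s - r|_S ^ 2];
    its move has size [O(e)], uniformly over the bounded input rectangle, which
    makes the move penalty and the excited dynamics [O(e^2)]. *)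
Lemma value_descent (N : 'cV[R[i]]_nd -> R) (rho c : R) :
  0 <= rho < 1 -> 0 <= c ->
  (forall z, l1norm z <= N z <= c * l1norm z) ->
  (forall z w, N (z + w) <= N z + N w) ->
  (forall z, N (sysF P *m z) <= rho * N z) ->
  exists (e0 K C : R), [/\ 0 < e0 <= 1, 0 <= K, 0 <= C &
    forall k e, 0 <= e <= e0 ->
    (value k <= ((1 - e) ^+ 2 * quad S (xs (x k) - r) + K * N (xd (x k)) ^+ 2
                 + C * e ^+ 2)%:E)%E].
Proof.
move=> rho01 c0 Nl1 ND NF.
have lN z : l1norm z <= N z by have /andP[] := Nl1 z.
have N0 z : 0 <= N z by exact: le_trans (l1norm_ge0 _) (lN z).
have [e0 e0P feas] := candidate_feasible.
have [K K0 hK] := cost_single_le r Rw S rho01 lN NF m_gt0 posQ.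
have [cR cR0 hcR] := quad_le_l1norm Rw.
pose W := \sum_i (umax i 0 - umin i 0).
pose M := c * (l1norm (sysDd P) * W).
have w0 i : 0 <= umax i 0 - umin i 0.
  by have := U_ur i; rewrite subr_ge0 => /andP[]; exact: le_trans.
have W0 : 0 <= W by exact: sumr_ge0.
have M0 : 0 <= M by rewrite !mulr_ge0 ?l1norm_ge0.
exists e0, (2 * K), (2 * K * M ^+ 2 + cR * W ^+ 2).
split => //; first by rewrite mulr_ge0.
  exact: addr_ge0 (mulr_ge0 (mulr_ge0 (ler0n _ 2) K0) (sqr_ge0 _))
    (mulr_ge0 cR0 (sqr_ge0 _)).
move=> k e ee0; have [e_ge0 _] := andP ee0.
set d := ur - inp (x k).
have dW : l1norm (map_mx (real_complex R) d) <= W.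
  rewrite l1norm_real; apply: ler_sum => i _.
  exact: rectangle_diff_le (closed_loop_inp k) U_ur.
have [_ h] := cl; have [[_ opt] _] := h k.
apply: le_trans (opt _ _ (feas k e ee0)) _.
apply: le_trans (hK _ _ _ (candidate_terminal k e)) _.
rewrite lee_fin -/d.
have qR : quad Rw (e *: d) <= e ^+ 2 * (cR * W ^+ 2).
  rewrite quadZ ler_wpM2l ?sqr_ge0//.
  have -> : d = map_mx (@complex.Re R) (map_mx (real_complex R) d).
    by apply/matrixP => i j; rewrite !mxE.
  apply: le_trans (hcR _) _; rewrite ler_wpM2l//.
  by rewrite ler_sqr ?nnegrE ?l1norm_ge0.
have Nstep : N (xd (step P (x k) (e *: d))) <= N (xd (x k)) + e * M.
  apply: le_trans (ND _ _) _; apply: lerD.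
    apply: le_trans (NF _) _; rewrite -[leRHS]mul1r ler_wpM2r//.
    by have /andP[_ /ltW] := rho01.
  have -> : map_mx (real_complex R) (e *: d) = real_complex R e *: map_mx (real_complex R) d.
    by apply/matrixP => i j; rewrite !mxE rmorphM.
  rewrite -scalemxAr.
  apply: le_trans (proj2 (andP (Nl1 _))) _.
  rewrite l1normZ normc_real ger0_norm// mulrCA ler_wpM2l// ler_wpM2l//.
  by rewrite (le_trans (ler_l1normM _ _))// ler_wpM2l ?l1norm_ge0.
have Nsq : N (xd (step P (x k) (e *: d))) ^+ 2
    <= 2 * N (xd (x k)) ^+ 2 + 2 * (e * M) ^+ 2.
  apply: (@le_trans _ _ ((N (xd (x k)) + e * M) ^+ 2)).
    have NM0 : 0 <= N (xd (x k)) + e * M by apply: addr_ge0 => //; exact: mulr_ge0.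
    by rewrite ler_sqr ?nnegrE ?N0.
  by have := sqr_ge0 (N (xd (x k)) - e * M); lra.
rewrite [quad S _]quadZ.
have := ler_wpM2l K0 Nsq; rewrite [(e * M) ^+ 2]exprMn; lra.
Qed.

End ClosedLoop.

Section Convergence.
Variables (R : realType) (nd ny nu : nat) (P : system R nd ny nu) (m : nat).
Variables (Q : 'M[R]_ny) (Rw : 'M[R]_nu) (S : 'M[R]_ny) (r : 'cV[R]_ny).
Variables (umin umax dumin dumax ur : 'cV[R]_nu).
Hypothesis m_gt0 : (0 < m)%N.
Hypotheses (posQ : posdef Q) (posRw : posdef Rw) (posS : posdef S).
Hypothesis U0 : rectangle umin umax 0.
Hypothesis dU_nbhs0 : forall i, dumin i 0 < 0 < dumax i 0.
Hypothesis F_stable : spectral_radius (sysF P) < 1.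
Hypothesis U_ur : rectangle umin umax ur.
Hypothesis rE : r = sysD0 P *m ur.
Variables (x : nat -> state R nd ny nu) (du : nat -> 'I_m -> 'cV[R]_nu).
Variable delta : nat -> 'cV[R]_ny.
Hypothesis cl : closed_loop P r Q Rw S (rectangle umin umax)
  (rectangle dumin dumax) x du delta.

(** Combines the two estimates: [V k >= |delta|_S ^ 2], where [delta] and
    [x_s - r] agree in the limit, and the first-order gain of the candidate. *)
Lemma value_cvg0 : value P Q Rw S r x du delta k @[k --> \oo] --> 0%E.
Proof.
have [N [rho [c [rho01 c0 Nl1 ND NF]]]] := contracting_norm F_stable.
have lN z : l1norm z <= N z by have /andP[] := Nl1 z.
have N0 z : 0 <= N z by exact: le_trans (l1norm_ge0 _) (lN z).
have [e0 [K [C [/andP[e00 e01] K0 C0 desc]]]] := value_descent m_gt0 posQ U0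
  dU_nbhs0 U_ur rE cl rho01 c0 Nl1 ND NF.
have V0 k : (0 <= value P Q Rw S r x du delta k)%E.
  apply: (le_trans _ (quad_slack_le_cost _ _ _ _ _ _ posQ posRw)).
  by rewrite lee_fin posdef_ge0.
pose v k := fine (value P Q Rw S r x du delta k).
have VE k : value P Q Rw S r x du delta k = (v k)%:E.
  rewrite fineK// ge0_fin_numE//.
  have e00' : 0 <= e0 <= e0 by rewrite lexx ltW.
  by apply: le_lt_trans (desc k e0 e00') _; exact: ltry.
have v0 k : 0 <= v k by rewrite fine_ge0.
have vstep k : quad Q (output P (x k.+1) - r - delta k.+1)
    + quad Rw (move (du k.+1) 0) + v k.+1 <= v k.
  have := value_step m_gt0 posQ dU_nbhs0 cl k.
  by rewrite !VE -EFinD lee_fin.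
have vdec k : v k.+1 <= v k.
  by apply: le_trans (vstep k); rewrite lerDr addr_ge0 ?posdef_ge0.
have cvv : cvgn v.
  apply: nonincreasing_is_cvgn; first exact/nonincreasing_seqP.
  by exists 0 => _ [k _ <-].
have gap0 : v k - v k.+1 @[k --> \oo] --> (0 : R).
  rewrite -(subrr (limn v)); apply: cvgB => //.
  by rewrite (cvg_shiftS v).
(* the implemented moves tend to 0, hence so does the dynamic state *)
have xd0 : N (xd (x k)) @[k --> \oo] --> (0 : R).
  have [cR cR0 hcR] := posdef_coercive posRw.
  pose b k := l1norm (map_mx (real_complex R) (move (du k.+1) 0)).
  have b0 : b k @[k --> \oo] --> (0 : R).
    apply: (@cvg0_sqr_le _ _ (fun k => cR * (v k - v k.+1))) => [k|k|].
    - exact: l1norm_ge0.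
    - apply: le_trans (hcR _) _; rewrite ler_wpM2l// lerBrDr.
      by apply: le_trans (vstep k); rewrite -addrA lerDr posdef_ge0.
    - by rewrite -(mulr0 cR); apply: cvgM => //; exact: cvg_cst.
  apply: (@perturbed_contraction_cvg0 _ _
    (fun k => c * l1norm (sysDd P) * b k) rho) => // [k|].
    rewrite (closed_loop_step cl) (le_trans (ND _ _))// lerD//.
    apply: le_trans (proj2 (andP (Nl1 _))) _.
    by rewrite -mulrA ler_wpM2l// ler_l1normM.
  by rewrite -(mulr0 (c * l1norm (sysDd P))); apply: cvgM => //; exact: cvg_cst.
have xdS0 : N (xd (x k.+1)) ^+ 2 @[k --> \oo] --> (0 : R).
  by apply: cvg0_sqr; rewrite (cvg_shiftS (fun k => N (xd (x k)))).
(* so the slack and the static tracking error differ by a vanishing amount *)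
pose h k := xs (x k.+1) - r - delta k.+1.
have [g g0 hg] : exists2 g : nat -> R, g k @[k --> \oo] --> (0 : R) &
    forall k, quad S (h k) <= g k.
  have [cS cS0 hcS] := quad_le_l1norm S.
  have [cQ cQ0 hcQ] := posdef_coercive posQ.
  have [cP cP0 hcP] := quad_dyn_output_le P lN S.
  exists (fun k => 2 * (cS * (cQ * (v k - v k.+1))) + 2 * (cP * N (xd (x k.+1)) ^+ 2)).
    rewrite -[0 in X in _ --> X](addr0 (0 : R)); apply: cvgD.
      rewrite -[0 in X in _ --> X](mulr0 (2 * (cS * cQ))).
      under eq_fun do rewrite (mulrA cS) (mulrA 2).
      by apply: cvgM => //; exact: cvg_cst.
    rewrite -[0 in X in _ --> X](mulr0 (2 * cP)).
    under eq_fun do rewrite (mulrA 2).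
    by apply: cvgM => //; exact: cvg_cst.
  move=> k.
  set y := map_mx (@complex.Re R) (dyn_output P (x k.+1)).
  set e := output P (x k.+1) - r - delta k.+1.
  have hE : h k = e + (-1) *: y.
    by rewrite /h /e /output -/y; apply/matrixP => i j; rewrite !mxE; ring.
  have := posdef_young e ((-1) *: y) posS ltr01; rewrite -hE quadZ sqrrN expr1n mul1r.
  rewrite invr1 => /le_trans; apply; apply: lerD; rewrite ler_wpM2l//; last exact: hcP.
  have -> : e = map_mx (@complex.Re R) (map_mx (real_complex R) e).
    by apply/matrixP => i j; rewrite !mxE.
  apply: le_trans (hcS _) _; rewrite ler_wpM2l//.
  apply: le_trans (hcQ _) _; rewrite ler_wpM2l// lerBrDr.
  by apply: le_trans (vstep k); rewrite -/e lerD2r lerDl posdef_ge0.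
suff : v k @[k --> \oo] --> (0 : R).
  move=> vl; under eq_fun do rewrite VE.
  apply: cvg_EFin => //; exact: nearW.
apply: (quadratic_descent_cvg0 e00 C0) => // e /andP[e_gt0 e_le].
have e1 : e <= 1 by exact: le_trans e01.
exists (fun k => (1 + e^-1) * g k + K * N (xd (x k.+1)) ^+ 2).
  rewrite -[0 in X in _ --> X](addr0 (0 : R)); apply: cvgD.
    rewrite -[0 in X in _ --> X](mulr0 (1 + e^-1)).
    by apply: cvgM => //; exact: cvg_cst.
  by rewrite -[0 in X in _ --> X](mulr0 K); apply: cvgM => //; exact: cvg_cst.
move=> k; have := desc k.+1 e; rewrite ltW// e_le VE lee_fin => /(_ isT).
have young := posdef_young (delta k.+1) (h k) posS e_gt0.
have -> : xs (x k.+1) - r = delta k.+1 + h k by rewrite [RHS]addrC subrK.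
have Sv : quad S (delta k.+1) <= v k.
  by rewrite -lee_fin -VE; exact: quad_slack_le_cost.
have := hg k; have := posdef_ge0 (delta k.+1) posS; have := posdef_ge0 (h k) posS.
move: young Sv.
move: (quad S (delta k.+1 + h k)) (quad S (delta k.+1)) (quad S (h k)) => q qd qh.
move=> young Sv qh0 qd0 qhg le_cand.
have ei0 : 0 <= e^-1 by rewrite invr_ge0 ltW.
have sq_ge0 : 0 <= (1 - e) ^+ 2 by exact: sqr_ge0.
have sq_le1 : (1 - e) ^+ 2 <= 1 by nra.
(* Young's inequality spends a factor [1 + e] of the gain [(1 - e)^2]; a
   contraction by [1 - e] remains *)
have damp : (1 - e) ^+ 2 * (1 + e) <= 1 - e by nra.
have t1 : (1 - e) ^+ 2 * q <= (1 - e) ^+ 2 * ((1 + e) * qd + (1 + e^-1) * qh).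
  exact: ler_wpM2l.
have t2 : (1 - e) ^+ 2 * (1 + e) * qd <= (1 - e) * v k.
  by apply: ler_pM => //; rewrite mulr_ge0//; lra.
have t3 : (1 - e) ^+ 2 * ((1 + e^-1) * qh) <= (1 + e^-1) * g k.
  rewrite -[leRHS]mul1r; apply: ler_pM => //; first by rewrite mulr_ge0//; lra.
  by rewrite ler_wpM2l//; lra.
lra.
Qed.

End Convergence.

(** * Convergence of the optimal cost to zero *)

Theorem theorem2p3 (R : realType) (nd ny nu : nat) (P : system R nd ny nu)
    (m : nat) (Q : 'M[R]_ny) (Rw : 'M[R]_nu)
    (umin umax dumin dumax : 'cV[R]_nu) (r : 'cV[R]_ny) :
  (0 < m)%N ->
  real_output P ->
  posdef Q -> posdef Rw ->
  rectangle umin umax 0 ->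
  (forall i, dumin i 0 < 0 < dumax i 0) ->
  spectral_radius (sysF P) < 1 ->
  (exists2 ur, rectangle umin umax ur & r = sysD0 P *m ur) ->
  exists S : 'M[R]_ny, posdef S /\
    forall (x : nat -> state R nd ny nu) (du : nat -> 'I_m -> 'cV[R]_nu)
           (delta : nat -> 'cV[R]_ny),
      closed_loop P r Q Rw S (rectangle umin umax) (rectangle dumin dumax)
        x du delta ->
      cost P r Q Rw S (x k.-1) (du k) (delta k) @[k --> \oo] --> 0%E.
Proof.
move=> m_gt0 _ posQ posRw U0 dU_nbhs0 F_stable [ur U_ur rE].
exists Q; split => // x du delta cl.
rewrite -(cvg_shiftS (fun k => cost P r Q Rw Q (x k.-1) (du k) (delta k))).
exact: (value_cvg0 m_gt0 posQ posRw posQ U0 dU_nbhs0 F_stable U_ur rE cl).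
Qed.
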